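(* Let $\pi:B\to A$ be a homomorphism of unital associative algebras over $\mathbb C$. Then $\mathrm{Ind}_B^A(-):\mathsf{Mod}(B)\rightleftarrows\mathsf{Mod}(A):\mathrm{Res}^A_B(-)$ is an adjoint pair of functors. In other words, there exists a canonical isomorphism of hom-spaces $$\mathrm{Hom}_A(\mathrm{Ind}_B^A(\Omega_M),K)\cong\mathrm{Hom}_B(\Omega_M,\mathrm{Res}^A_B(K))$$ for any left $B$-module $\Omega_M$ and any left $A$-module $K$.
   Context: $\mathsf{Mod}(A)$ and $\mathsf{Mod}(B)$ are the categories of left modules. $\mathrm{Res}^A_B$ is restriction of scalars along $\pi$. For a left $B$-module $\Omega_M$, $\Omega_M/\ker(\pi).\Omega_M$ is a left $\pi(B)$-module via $\pi(b).\bar v=\overline{b.v}$, and $$\mathrm{Ind}_B^A(\Omega_M)=A\otimes_{\pi(B)}\left(\Omega_M/\ker(\pi).\Omega_M\right);$$ on a morphism $f:\Omega_M\to\Omega_W$, $\mathrm{Ind}_B^A(f)(a\otimes\bar v)=a\otimes\overline{f(v)}$. *)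

(* Defs.v *)
From HB Require Import structures.
From mathcomp Require Import all_boot all_algebra.
From mathcomp Require Import ring_quotient freeg boolp reals complex.

Set Implicit Arguments.
Unset Strict Implicit.
Unset Printing Implicit Defensive.

Import GRing.Theory.
Local Open Scope ring_scope.
Local Open Scope quotient_scope.

(* Unital associative k-algebras. This is algType without the requirement 1 != 0,
   so that the zero algebra is allowed (algebra_of_algType embeds algType). *)
Record algebra (k : pzRingType) := Algebra {
  alg_ring :> pzRingType;
  ascale : k -> alg_ring -> alg_ring;
  ascaleA : forall a b x, ascale a (ascale b x) = ascale (a * b) x;
  ascale1 : left_id 1 ascale;
  ascaleDr : right_distributive ascale +%R;
  ascaleDl : forall x, {morph ascale^~ x : a b / a + b};
  ascaleAl : forall a x y, ascale a (x * y) = ascale a x * y;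
  ascaleAr : forall a x y, ascale a (x * y) = x * ascale a y
}.
Arguments ascale {k a} c x : rename.

Definition algebra_of_algType (k : pzRingType) (A : algType k) : algebra k :=
  @Algebra k A *:%R (@scalerA k A) (@scale1r k A) (@scalerDr k A)
    (fun x a b => scalerDl x a b) (@scalerAl k A) (@scalerAr k A).

Definition alg_linear (k : pzRingType) (B A : algebra k) (f : B -> A) : Prop :=
  forall (c : k) (b : B), f (ascale c b) = ascale c (f b).

Record category := Category {
  obj :> Type;
  hom : obj -> obj -> Type;
  idm : forall X, hom X X;
  cmp : forall X Y Z, hom Y Z -> hom X Y -> hom X Z;
  cmp1m : forall X Y (f : hom X Y), cmp (idm Y) f = f;
  cmpm1 : forall X Y (f : hom X Y), cmp f (idm X) = f;
  cmpA : forall X Y Z T (h : hom Z T) (g : hom Y Z) (f : hom X Y),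
    cmp h (cmp g f) = cmp (cmp h g) f
}.
Arguments hom {c} X Y.
Arguments idm {c} X.
Arguments cmp {c X Y Z} g f.

Record functor (C D : category) := Functor {
  fobj :> C -> D;
  fmap : forall X Y : C, hom X Y -> hom (fobj X) (fobj Y);
  fmap1 : forall X, fmap (idm X) = idm (fobj X);
  fmapM : forall X Y Z (g : hom Y Z) (f : hom X Y),
    fmap (cmp g f) = cmp (fmap g) (fmap f)
}.
Arguments fmap {C D} f {X Y} u : rename.

(* phi exhibits F as left adjoint to G. *)
Definition is_adjunction (C D : category) (F : functor C D) (G : functor D C)
    (phi : forall (X : C) (Y : D), hom (F X) Y -> hom X (G Y)) : Prop :=
  (forall X Y, bijective (phi X Y)) /\
  (forall (X X' : C) (Y Y' : D) (f : hom X' X) (g : hom Y Y') (h : hom (F X) Y),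
     phi X' Y' (cmp g (cmp h (fmap F f))) = cmp (fmap G g) (cmp (phi X Y h) f)).

Lemma linear_ext (A : pzRingType) (M N : lmodType A) (f g : {linear M -> N}) :
  f =1 g -> f = g.
Proof.
case: f => f [[f1] [f2]]; case: g => g [[g1] [g2]] /= /funext fg.
by case: _ / fg in g1 g2 *; rewrite (Prop_irrelevance f1 g1) (Prop_irrelevance f2 g2).
Qed.

Definition ModHom (k : pzRingType) (A : algebra k) (M N : lmodType A) : Type :=
  {linear M -> N}.
Identity Coercion linear_of_ModHom : ModHom >-> GRing.Linear.type.

Section HomSpace.
Variables (k : pzRingType) (A : algebra k) (M N : lmodType A).
Implicit Types (f g : ModHom M N) (c : k).

HB.instance Definition _ := gen_eqMixin (ModHom M N).
HB.instance Definition _ := gen_choiceMixin (ModHom M N).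

(* The k-action on an A-module is that of the multiples of 1 in A. *)
Definition kscale c (x : N) : N := ascale c (1 : A) *: x.

Lemma kscale_linear c : linear (kscale c).
Proof.
move=> a x y; rewrite /kscale scalerDr !scalerA.
by rewrite -ascaleAl -ascaleAr mul1r mulr1.
Qed.

Definition hom_zero : ModHom M N := (\0 : {linear M -> N}).
Definition hom_opp f : ModHom M N := (\- f : {linear M -> N}).
Definition hom_add f g : ModHom M N := (f \+ g : {linear M -> N}).

Lemma hom_scale_linear c f : linear (fun x => kscale c (f x)).
Proof. by move=> a x y; rewrite linearP kscale_linear. Qed.
Definition hom_scale c f : ModHom M N :=
  HB.pack (fun x => kscale c (f x))
    (GRing.isLinear.Build A M N *:%R _ (hom_scale_linear c f)).

Lemma hom_addA : associative hom_add.
Proof. by move=> f g h; apply: linear_ext => x /=; rewrite addrA. Qed.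
Lemma hom_addC : commutative hom_add.
Proof. by move=> f g; apply: linear_ext => x /=; rewrite addrC. Qed.
Lemma hom_add0 : left_id hom_zero hom_add.
Proof. by move=> f; apply: linear_ext => x /=; rewrite add0r. Qed.
Lemma hom_addN : left_inverse hom_zero hom_opp hom_add.
Proof. by move=> f; apply: linear_ext => x /=; rewrite addNr. Qed.
HB.instance Definition _ :=
  GRing.isZmodule.Build (ModHom M N) hom_addA hom_addC hom_add0 hom_addN.

Lemma hom_scaleA a b f : hom_scale a (hom_scale b f) = hom_scale (a * b) f.
Proof.
by apply: linear_ext => x /=; rewrite /kscale scalerA -ascaleAl mul1r ascaleA.
Qed.
Lemma hom_scale1 : left_id 1 hom_scale.
Proof. by move=> f; apply: linear_ext => x /=; rewrite /kscale ascale1 scale1r. Qed.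
Lemma hom_scaleDr : right_distributive hom_scale +%R.
Proof. by move=> c f g; apply: linear_ext => x /=; rewrite /kscale scalerDr. Qed.
Lemma hom_scaleDl f : {morph hom_scale^~ f : a b / a + b}.
Proof. by move=> a b; apply: linear_ext => x /=; rewrite /kscale ascaleDl scalerDl. Qed.
HB.instance Definition _ := GRing.Zmodule_isLmodule.Build k (ModHom M N)
  hom_scaleA hom_scale1 hom_scaleDr hom_scaleDl.

End HomSpace.

Section ModCategory.
Variables (k : pzRingType) (A : algebra k).

Definition id_Hom (M : lmodType A) : ModHom M M := (idfun : {linear M -> M}).
Definition comp_Hom (M N P : lmodType A) (g : ModHom N P) (f : ModHom M N) : ModHom M P :=
  (g \o f : {linear M -> P}).

Lemma comp_Hom1m M N (f : ModHom M N) : comp_Hom (id_Hom N) f = f.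
Proof. exact: linear_ext. Qed.
Lemma comp_Homm1 M N (f : ModHom M N) : comp_Hom f (id_Hom M) = f.
Proof. exact: linear_ext. Qed.
Lemma comp_HomA M N P Q (h : ModHom P Q) (g : ModHom N P) (f : ModHom M N) :
  comp_Hom h (comp_Hom g f) = comp_Hom (comp_Hom h g) f.
Proof. exact: linear_ext. Qed.

Definition Mod : category :=
  @Category (lmodType A) (@ModHom k A) id_Hom comp_Hom
    comp_Hom1m comp_Homm1 comp_HomA.

End ModCategory.

Section QuotientGroup.
Variables (V : zmodType) (G : V -> Prop).

Inductive generated : V -> Prop :=
| generated_mem x : G x -> generated x
| generated0 : generated 0
| generatedB x y : generated x -> generated y -> generated (x - y).

Definition subgroup_gen : {pred V} := fun x => `[< generated x >].

Lemma subgroup_gen_zmod_closed : zmod_closed subgroup_gen.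
Proof.
split=> [|x y /asboolP Gx /asboolP Gy]; apply/asboolP; first exact: generated0.
exact: generatedB.
Qed.
HB.instance Definition _ :=
  GRing.isZmodClosed.Build V subgroup_gen subgroup_gen_zmod_closed.

Definition quotg : Type := Quotient.quot subgroup_gen.
HB.instance Definition _ := GRing.Zmodule.on quotg.

Definition qclass (x : V) : quotg := \pi_(Quotient.quot subgroup_gen) x.
Definition qrepr (q : quotg) : V := repr (q : Quotient.quot subgroup_gen).

Lemma qreprK q : qclass (qrepr q) = q.
Proof. exact: reprK. Qed.

Lemma qclass_zmod : zmod_morphism qclass.
Proof. by move=> x y; exact: (raddfB (\pi_(Quotient.quot subgroup_gen))). Qed.
HB.instance Definition _ := GRing.isZmodMorphism.Build V quotg qclass qclass_zmod.

Lemma qclass_eq x y : qclass x = qclass y <-> generated (x - y).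
Proof.
rewrite /qclass; split=> [/eqP|xy]; last (apply/eqP; rewrite -Quotient.idealrBE).
  by rewrite -Quotient.idealrBE => /asboolP.
exact/asboolP.
Qed.

Lemma qclass0 x : G x -> qclass x = 0.
Proof. by move=> Gx; rewrite -(raddf0 qclass) qclass_eq subr0; constructor. Qed.

Variables (W : zmodType) (h : {additive V -> W}).

(* Only meaningful when h kills G, in which case qlift_class characterizes it. *)
Definition qlift (q : quotg) : W := h (qrepr q).

Hypothesis hG : forall x, G x -> h x = 0.

Lemma qlift_class x : qlift (qclass x) = h x.
Proof.
apply/eqP; rewrite -subr_eq0 -raddfB; apply/eqP.
have: generated (qrepr (qclass x) - x) by rewrite -qclass_eq qreprK.
by elim=> [y /hG||y z _ hy _ hz]; rewrite ?raddf0 // raddfB hy hz subr0.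
Qed.

Lemma qlift_zmod : zmod_morphism qlift.
Proof.
move=> x y; rewrite -[x]qreprK -[y]qreprK -(raddfB qclass).
by rewrite !qlift_class raddfB.
Qed.

End QuotientGroup.

Section FreeLift.
Variables (K : choiceType) (M : zmodType) (f : K -> M).

Definition free_lift (D : {freeg K}) : M := @fglift int (zmodule M) K f D.

Lemma free_lift_zmod : zmod_morphism free_lift.
Proof. exact: (@lift_is_additive int K (zmodule M) f). Qed.
HB.instance Definition _ :=
  GRing.isZmodMorphism.Build {freeg K} M free_lift free_lift_zmod.

Lemma free_liftU x : free_lift << x >> = f x.
Proof. by rewrite /free_lift liftU. Qed.

Lemma free_ext (g h : {additive {freeg K} -> M}) :
  (forall x, g << x >> = h << x >>) -> g =1 h.
Proof.
move=> gh D; rewrite -[D]freeg_sumE !raddf_sum; apply: eq_bigr => x _.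
by rewrite -[coeff x D]intz -freegU_mulz !raddfMz gh.
Qed.

End FreeLift.

(* A \otimes_S V, with A a right S-module through phi, as the quotient of the
   free abelian group on A * V by the balanced biadditivity relations. *)
Section Tensor.
Variables (S A : pzRingType) (phi : {rmorphism S -> A}).

Inductive tensor_rel (V : lmodType S) : {freeg (A * V)%type} -> Prop :=
| tensor_relDl a a' v :
    tensor_rel (<< (a + a', v) >> - << (a, v) >> - << (a', v) >>)
| tensor_relDr a v v' :
    tensor_rel (<< (a, v + v') >> - << (a, v) >> - << (a, v') >>)
| tensor_relZ a s v :
    tensor_rel (<< (a * phi s, v) >> - << (a, s *: v) >>).

Definition tensor (V : lmodType S) : Type := quotg (@tensor_rel V).
HB.instance Definition _ V := GRing.Zmodule.on (tensor V).

Definition tens (V : lmodType S) (a : A) (v : V) : tensor V :=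
  qclass (@tensor_rel V) << (a, v) >>.

Section Universal.
Variables (V : lmodType S) (M : zmodType) (f : A -> V -> M).
Hypothesis fDl : forall a a' v, f (a + a') v = f a v + f a' v.
Hypothesis fDr : forall a v v', f a (v + v') = f a v + f a v'.
Hypothesis fZ : forall a s v, f (a * phi s) v = f a (s *: v).

Definition tensor_lift : tensor V -> M :=
  qlift (free_lift (fun p : A * V => f p.1 p.2)).

Lemma tensor_lift_rel x :
  tensor_rel x -> free_lift (fun p : A * V => f p.1 p.2) x = 0.
Proof.
case=> [a a' v|a v v'|a s v]; rewrite !raddfB /= !free_liftU /=.
- by rewrite fDl addrAC addrK subrr.
- by rewrite fDr addrAC addrK subrr.
- by rewrite fZ subrr.
Qed.

Lemma tensor_lift_zmod : zmod_morphism tensor_lift.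
Proof. exact/qlift_zmod/tensor_lift_rel. Qed.

Lemma tensor_liftE a v : tensor_lift (tens a v) = f a v.
Proof. by rewrite /tensor_lift (qlift_class tensor_lift_rel) /= free_liftU. Qed.
End Universal.

Section TensorTheory.
Variable V : lmodType S.

Lemma tensDl a a' (v : V) : tens (a + a') v = tens a v + tens a' v.
Proof.
apply/eqP; rewrite -subr_eq0 opprD addrA -!raddfB.
by apply/eqP/qclass0; exact: tensor_relDl.
Qed.
Lemma tensDr a (v v' : V) : tens a (v + v') = tens a v + tens a v'.
Proof.
apply/eqP; rewrite -subr_eq0 opprD addrA -!raddfB.
by apply/eqP/qclass0; exact: tensor_relDr.
Qed.
Lemma tensZ a s (v : V) : tens (a * phi s) v = tens a (s *: v).
Proof.
by apply/eqP; rewrite -subr_eq0 -!raddfB; apply/eqP/qclass0; exact: tensor_relZ.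
Qed.

Lemma tensor_ext (M : zmodType) (g h : tensor V -> M) :
    zmod_morphism g -> zmod_morphism h ->
  (forall a v, g (tens a v) = h (tens a v)) -> g =1 h.
Proof.
move=> gB hB gh q; rewrite -[q]qreprK.
pose ga : {additive tensor V -> M} := HB.pack g (GRing.isZmodMorphism.Build _ _ g gB).
pose ha : {additive tensor V -> M} := HB.pack h (GRing.isZmodMorphism.Build _ _ h hB).
apply: (@free_ext _ _ (ga \o qclass (@tensor_rel V)) (ha \o qclass (@tensor_rel V))).
by case=> a v; exact: gh.
Qed.

Definition tensor_scale (b : A) : tensor V -> tensor V :=
  tensor_lift (fun a v => tens (b * a) v).

Lemma tensor_scaleU b a (v : V) : tensor_scale b (tens a v) = tens (b * a) v.
Proof.
apply: tensor_liftE => [a1 a2 w|a1 w w'|a1 s w].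
- by rewrite mulrDr tensDl.
- by rewrite tensDr.
- by rewrite mulrA tensZ.
Qed.

Lemma tensor_scale_zmod b : zmod_morphism (tensor_scale b).
Proof.
apply: tensor_lift_zmod => [a1 a2 w|a1 w w'|a1 s w].
- by rewrite mulrDr tensDl.
- by rewrite tensDr.
- by rewrite mulrA tensZ.
Qed.
HB.instance Definition _ b := GRing.isZmodMorphism.Build
  (tensor V) (tensor V) (tensor_scale b) (tensor_scale_zmod b).

Lemma tensor_scaleA a b x :
  tensor_scale a (tensor_scale b x) = tensor_scale (a * b) x.
Proof.
move: x; apply: tensor_ext; try by move=> x y; rewrite !raddfB.
by move=> c v; rewrite !tensor_scaleU mulrA.
Qed.
Lemma tensor_scale1 : left_id 1 tensor_scale.
Proof.
apply: tensor_ext; try by move=> x y; rewrite ?raddfB.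
by move=> c v; rewrite !tensor_scaleU mul1r.
Qed.
Lemma tensor_scaleDr : right_distributive tensor_scale +%R.
Proof. by move=> a x y; rewrite raddfD. Qed.
Lemma tensor_scaleDl x : {morph tensor_scale^~ x : a b / a + b}.
Proof.
move=> a b; move: x; apply: tensor_ext; first exact: raddfB.
  by move=> x y; rewrite !raddfB opprD addrACA.
by move=> c v; rewrite !tensor_scaleU mulrDl tensDl.
Qed.
HB.instance Definition _ := GRing.Zmodule_isLmodule.Build A (tensor V)
  tensor_scaleA tensor_scale1 tensor_scaleDr tensor_scaleDl.

Lemma tensor_scaleE b a (v : V) : b *: tens a v = tens (b * a) v.
Proof. exact: tensor_scaleU. Qed.

End TensorTheory.

Section TensorMap.
Variables (V W : lmodType S) (f : {linear V -> W}).

Definition tensor_map : tensor V -> tensor W :=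
  tensor_lift (fun a v => tens a (f v)).

Lemma tensor_mapE a v : tensor_map (tens a v) = tens a (f v).
Proof.
apply: tensor_liftE => [a1 a2 w|a1 w w'|a1 s w].
- by rewrite tensDl.
- by rewrite linearD tensDr.
- by rewrite linearZ tensZ.
Qed.

Lemma tensor_map_zmod : zmod_morphism tensor_map.
Proof.
apply: tensor_lift_zmod => [a1 a2 w|a1 w w'|a1 s w].
- by rewrite tensDl.
- by rewrite linearD tensDr.
- by rewrite linearZ tensZ.
Qed.
HB.instance Definition _ :=
  GRing.isZmodMorphism.Build (tensor V) (tensor W) tensor_map tensor_map_zmod.

Lemma tensor_map_scalable : scalable tensor_map.
Proof.
move=> b; apply: tensor_ext; try by move=> x y; rewrite !(raddfB, scalerBr).
by move=> a v; rewrite tensor_scaleE !tensor_mapE tensor_scaleE.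
Qed.
HB.instance Definition _ := GRing.isScalable.Build A (tensor V) (tensor W)
  *:%R tensor_map tensor_map_scalable.

End TensorMap.
End Tensor.

Section Image.
Variables (A B : pzRingType) (pi : {rmorphism B -> A}).

Definition in_image : {pred A} := fun a => `[< exists b, pi b = a >].

Lemma in_image_subring : subring_closed in_image.
Proof.
split; first by apply/asboolP; exists 1; rewrite rmorph1.
  move=> _ _ /asboolP[b <-] /asboolP[c <-]; apply/asboolP; exists (b - c).
  by rewrite rmorphB.
move=> _ _ /asboolP[b <-] /asboolP[c <-]; apply/asboolP; exists (b * c).
by rewrite rmorphM.
Qed.

Record image := Image { image_val : A; image_valP : image_val \in in_image }.
HB.instance Definition _ := [isSub for image_val].
HB.instance Definition _ := [Choice of image by <:].
HB.instance Definition _ :=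
  GRing.SubChoice_isSubPzRing.Build A in_image image in_image_subring.

Definition incl : {rmorphism image -> A} := (val : {rmorphism image -> A}).

Lemma image_mem b : pi b \in in_image.
Proof. by apply/asboolP; exists b. Qed.
Definition to_image (b : B) : image := Image (image_mem b).

Lemma image_ex (s : image) : exists b, pi b == val s.
Proof. by have /asboolP[b <-] := valP s; exists b. Qed.
Definition preim (s : image) : B := xchoose (image_ex s).
Lemma preimK s : pi (preim s) = val s.
Proof. exact/eqP/(xchooseP (image_ex s)). Qed.

End Image.

(* ker(pi).V is the additive subgroup generated by the b *: v with b in ker(pi). *)
Section KerQuotient.
Variables (A B : pzRingType) (pi : {rmorphism B -> A}).

Definition ker_gen (V : lmodType B) (x : V) : Prop :=
  exists b v, pi b = 0 /\ x = b *: v.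

Definition kerquot (V : lmodType B) : Type := quotg (@ker_gen V).
HB.instance Definition _ V := GRing.Zmodule.on (kerquot V).

Definition bar (V : lmodType B) (v : V) : kerquot V := qclass (@ker_gen V) v.
Lemma bar_zmod (V : lmodType B) : zmod_morphism (@bar V).
Proof. exact: qclass_zmod. Qed.
HB.instance Definition _ (V : lmodType B) :=
  GRing.isZmodMorphism.Build V (kerquot V) (@bar V) (@bar_zmod V).

Section Action.
Variable V : lmodType B.

Lemma bar_surj (q : kerquot V) : exists v, bar v = q.
Proof. by exists (qrepr q); exact: qreprK. Qed.

Definition barZ (b : B) (v : V) : kerquot V := bar (b *: v).
Lemma barZ_zmod b : zmod_morphism (barZ b).
Proof. by move=> x y; rewrite /barZ scalerBr raddfB. Qed.
HB.instance Definition _ b :=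
  GRing.isZmodMorphism.Build V (kerquot V) (barZ b) (barZ_zmod b).

Lemma barZ_ker b x : ker_gen x -> barZ b x = 0.
Proof.
case=> c [v [pc ->]]; apply: qclass0; exists (b * c), v.
by rewrite rmorphM pc mulr0 scalerA.
Qed.

(* preim s is some b with pi b = s; kerquot_scaleE: the choice is irrelevant. *)
Definition kerquot_scale (s : image pi) : kerquot V -> kerquot V :=
  qlift (barZ (preim s)).

Lemma kerquot_scaleU b v : kerquot_scale (to_image pi b) (bar v) = bar (b *: v).
Proof.
rewrite /kerquot_scale (qlift_class (@barZ_ker _)).
apply/qclass_eq/generated_mem; exists (preim (to_image pi b) - b), v.
by rewrite rmorphB preimK subrr scalerBl.
Qed.

Lemma to_image_preim (s : image pi) : s = to_image pi (preim s).
Proof. by apply/val_inj; rewrite /= preimK. Qed.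

Lemma to_image_eq (s : image pi) b : pi b = val s -> s = to_image pi b.
Proof. by move=> bs; apply/val_inj. Qed.

Lemma kerquot_scaleA s t q :
  kerquot_scale s (kerquot_scale t q) = kerquot_scale (s * t) q.
Proof.
have [v <-] := bar_surj q.
have -> : s * t = to_image pi (preim s * preim t).
  by apply: to_image_eq; rewrite rmorphM !preimK.
rewrite [t in LHS]to_image_preim [s in LHS]to_image_preim.
by rewrite !kerquot_scaleU scalerA.
Qed.
Lemma kerquot_scale1 : left_id 1 kerquot_scale.
Proof.
move=> q; have [v <-] := bar_surj q.
have -> : 1 = to_image pi 1 by apply: to_image_eq; rewrite rmorph1.
by rewrite kerquot_scaleU scale1r.
Qed.
Lemma kerquot_scaleDr : right_distributive kerquot_scale +%R.
Proof.
move=> s q r; have [v <-] := bar_surj q; have [w <-] := bar_surj r.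
by rewrite -raddfD [s]to_image_preim !kerquot_scaleU scalerDr raddfD.
Qed.
Lemma kerquot_scaleDl q : {morph kerquot_scale^~ q : s t / s + t}.
Proof.
move=> s t; have [v <-] := bar_surj q.
have -> : s + t = to_image pi (preim s + preim t).
  by apply: to_image_eq; rewrite rmorphD !preimK.
rewrite [s in RHS]to_image_preim [t in RHS]to_image_preim.
by rewrite !kerquot_scaleU scalerDl raddfD.
Qed.
HB.instance Definition _ := GRing.Zmodule_isLmodule.Build (image pi) (kerquot V)
  kerquot_scaleA kerquot_scale1 kerquot_scaleDr kerquot_scaleDl.

Lemma kerquot_scaleE b v : to_image pi b *: bar v = bar (b *: v).
Proof. exact: kerquot_scaleU. Qed.

End Action.

Section KerMap.
Variables (V W : lmodType B) (f : {linear V -> W}).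

Definition barf (v : V) : kerquot W := bar (f v).
Lemma barf_zmod : zmod_morphism barf.
Proof. by move=> x y; rewrite /barf !raddfB. Qed.
HB.instance Definition _ :=
  GRing.isZmodMorphism.Build V (kerquot W) barf barf_zmod.

Lemma barf_ker x : ker_gen x -> barf x = 0.
Proof.
case=> c [v [pc ->]]; apply: qclass0; exists c, (f v).
by rewrite linearZ.
Qed.

Definition kerquot_map : kerquot V -> kerquot W := qlift barf.

Lemma kerquot_mapE v : kerquot_map (bar v) = bar (f v).
Proof. exact/qlift_class/barf_ker. Qed.

Lemma kerquot_map_linear : linear kerquot_map.
Proof.
move=> s q r; have [v <-] := bar_surj q; have [w <-] := bar_surj r.
rewrite [s]to_image_preim kerquot_scaleE -raddfD !kerquot_mapE.
by rewrite kerquot_scaleE -raddfD linearP.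
Qed.
HB.instance Definition _ := GRing.isLinear.Build (image pi)
  (kerquot V) (kerquot W) *:%R kerquot_map kerquot_map_linear.

End KerMap.
End KerQuotient.

Arguments tensor_map {S A} phi {V W} f _.
Arguments kerquot_map {A B} pi {V W} f _.

Section InductionRestriction.
Variables (k : pzRingType) (A B : algebra k) (pi : {rmorphism B -> A}).

(* A \otimes_{pi(B)} (V / ker(pi).V) *)
Definition Ind_obj (V : lmodType B) : lmodType A :=
  tensor (incl pi) (kerquot pi V).

Definition Ind_map (V W : lmodType B) (f : ModHom V W) :
    ModHom (Ind_obj V) (Ind_obj W) :=
  (tensor_map (incl pi) (kerquot_map pi f)
     : {linear tensor (incl pi) (kerquot pi V) -> tensor (incl pi) (kerquot pi W)}).

Lemma Ind_mapE (V W : lmodType B) (f : ModHom V W) (a : A) (v : V) :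
  Ind_map f (tens (incl pi) a (bar pi v)) = tens (incl pi) a (bar pi (f v)).
Proof. by rewrite [LHS]tensor_mapE [in LHS]/= kerquot_mapE. Qed.

Lemma Ind_ext (V : lmodType B) (M : lmodType A) (f g : ModHom (Ind_obj V) M) :
    (forall a v, f (tens (incl pi) a (bar pi v)) = g (tens (incl pi) a (bar pi v))) ->
  f = g.
Proof.
move=> fg; apply: linear_ext.
apply: tensor_ext => [x y|x y|a q]; rewrite ?raddfB //.
by have [v <-] := bar_surj q.
Qed.

Lemma Ind_map1 V : Ind_map (id_Hom V) = id_Hom (Ind_obj V).
Proof. by apply: Ind_ext => a v; rewrite Ind_mapE. Qed.
Lemma Ind_mapM U V W (g : ModHom V W) (f : ModHom U V) :
  Ind_map (comp_Hom g f) = comp_Hom (Ind_map g) (Ind_map f).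
Proof.
apply: Ind_ext => a v; rewrite Ind_mapE.
by rewrite -[RHS]/(Ind_map g (Ind_map f _)) [Ind_map f _]Ind_mapE Ind_mapE.
Qed.
Definition Ind : functor (Mod B) (Mod A) :=
  @Functor (Mod B) (Mod A) Ind_obj Ind_map Ind_map1 Ind_mapM.

Definition restr (K : lmodType A) : Type := K.

Section RestrObj.
Variable K : lmodType A.
HB.instance Definition _ := GRing.Zmodule.on (restr K).

Definition restr_scale (b : B) (x : restr K) : restr K := (pi b : A) *: (x : K).
Lemma restr_scaleA a b x : restr_scale a (restr_scale b x) = restr_scale (a * b) x.
Proof. by rewrite /restr_scale scalerA rmorphM. Qed.
Lemma restr_scale1 : left_id 1 restr_scale.
Proof. by move=> x; rewrite /restr_scale rmorph1 scale1r. Qed.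
Lemma restr_scaleDr : right_distributive restr_scale +%R.
Proof. by move=> a x y; rewrite /restr_scale scalerDr. Qed.
Lemma restr_scaleDl x : {morph restr_scale^~ x : a b / a + b}.
Proof. by move=> a b; rewrite /restr_scale rmorphD scalerDl. Qed.

Definition Res_obj : lmodType B :=
  HB.pack (restr K) (GRing.Zmodule_isLmodule.Build B (restr K)
    restr_scaleA restr_scale1 restr_scaleDr restr_scaleDl).
End RestrObj.

Section RestrMap.
Variables (K L : lmodType A) (f : ModHom K L).
Lemma restr_map_linear : linear (f : Res_obj K -> Res_obj L).
Proof. by move=> b x y; exact: linearP. Qed.
Definition Res_map : ModHom (Res_obj K) (Res_obj L) :=
  HB.pack (f : Res_obj K -> Res_obj L)
    (GRing.isLinear.Build B (Res_obj K) (Res_obj L) *:%R _ restr_map_linear).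
End RestrMap.

Lemma Res_map1 K : Res_map (id_Hom K) = id_Hom (Res_obj K).
Proof. exact: linear_ext. Qed.
Lemma Res_mapM K L M (g : ModHom L M) (f : ModHom K L) :
  Res_map (comp_Hom g f) = comp_Hom (Res_map g) (Res_map f).
Proof. exact: linear_ext. Qed.
Definition Res : functor (Mod A) (Mod B) :=
  @Functor (Mod A) (Mod B) Res_obj Res_map Res_map1 Res_mapM.

End InductionRestriction.

(* Main.v *)
Require Import Defs.
From HB Require Import structures.
From mathcomp Require Import all_boot all_algebra.
From mathcomp Require Import reals complex.
Import GRing.Theory.
Local Open Scope ring_scope.

(** Induction is left adjoint to restriction because [Ind pi Omega] is generated
    over [A] by the elements [1 \otimes \bar v], and the only relations among
    these are the ones forced by [B]-linearity of [v |-> 1 \otimes \bar v].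

    Composing an [A]-linear map [h] out of [Ind pi Omega] with
    [v |-> 1 \otimes \bar v] ([transpose]) gives a [B]-linear map: the scalar
    [b] passes through the tensor sign as [pi b], which is exactly how [b] acts
    on [Res pi K]. Conversely a [B]-linear [g : Omega -> Res pi K] kills
    [ker(pi).Omega], since [ker(pi)] acts by zero on [Res pi K]; it therefore
    descends to a [pi(B)]-linear map on the quotient ([descend]), and
    [a \otimes \bar v |-> a.g(v)] is balanced over [pi(B)] ([untranspose]).
    The two constructions are mutually inverse because an [A]-linear map out of
    [Ind pi Omega] is determined by its values on the [1 \otimes \bar v], and
    naturality holds already on elements.

    The bijection is linear over the ground ring because that ring acts on the
    two hom-spaces through the multiples of [1] in [A] and in [B] respectively,
    and [pi], being linear, sends the latter to the former. *)

Section Transpose.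
Set Implicit Arguments.
Unset Strict Implicit.
Variables (k : pzRingType) (A B : algebra k) (pi : {rmorphism B -> A}).
Variables (Omega : lmodType B) (K : lmodType A).

Definition transpose_fun (h : ModHom (Ind_obj pi Omega) K) (v : Omega) :
  Res_obj pi K := h (tens (incl pi) 1 (bar pi v)).

(** A scalar crosses the tensor sign: since [\bar{b.v} = pi(b).\bar v],
    [1 \otimes \bar{b.v} = pi(b) \otimes \bar v = pi(b).(1 \otimes \bar v)]. *)
Lemma transpose_linear h : linear (transpose_fun h).
Proof.
move=> b v w; rewrite /transpose_fun (raddfD (@bar _ _ pi Omega)) tensDr raddfD.
congr (_ + _).
rewrite [in LHS]/= -kerquot_scaleE -tensZ mul1r [in LHS]/=.
by rewrite -[pi b]mulr1 -tensor_scaleE linearZ.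
Qed.

Definition transpose h : ModHom Omega (Res_obj pi K) :=
  HB.pack (transpose_fun h)
    (GRing.isLinear.Build B Omega (Res_obj pi K) *:%R _ (transpose_linear h)).

Section Untranspose.
Variable g : ModHom Omega (Res_obj pi K).

(** The reason the quotient by [ker(pi).Omega] loses no map into a restricted
    module: [g (b.v) = pi(b).g(v)], which is zero for [b] in [ker(pi)]. *)
Lemma Res_ker_gen x : ker_gen pi x -> g x = 0.
Proof.
case=> b [v [pib0 ->]]; rewrite linearZ.
by rewrite -[LHS]/(pi b *: (g v : K)) pib0 scale0r.
Qed.

Definition descend : kerquot pi Omega -> K := qlift g.

Lemma descend_bar v : descend (bar pi v) = g v.
Proof. exact: (qlift_class Res_ker_gen). Qed.

Lemma descendD q r : descend (q + r) = descend q + descend r.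
Proof.
have [v <-] := bar_surj q; have [w <-] := bar_surj r.
by rewrite -raddfD !descend_bar raddfD.
Qed.

(** Makes [a, q |-> a.descend(q)] balanced over [pi(B)]; every scalar of [pi(B)]
    is some [pi(b)], for which this is the [B]-linearity of [g]. *)
Lemma descendZ s q : descend (s *: q) = incl pi s *: descend q.
Proof.
have [v <-] := bar_surj q.
rewrite [s in LHS]to_image_preim kerquot_scaleE !descend_bar linearZ.
by rewrite -[LHS]/(pi (Defs.preim s) *: (g v : K)) preimK.
Qed.

Definition untranspose_fun : Ind_obj pi Omega -> K :=
  tensor_lift (fun a q => a *: descend q).

Lemma untranspose_tens a q :
  untranspose_fun (tens (incl pi) a q) = a *: descend q.
Proof.
apply: tensor_liftE => [a1 a2 r|a1 r r'|a1 s r].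
- exact: scalerDl.
- by rewrite descendD scalerDr.
- by rewrite descendZ scalerA.
Qed.

Lemma untranspose_zmod : zmod_morphism untranspose_fun.
Proof.
apply: tensor_lift_zmod => [a1 a2 r|a1 r r'|a1 s r].
- exact: scalerDl.
- by rewrite descendD scalerDr.
- by rewrite descendZ scalerA.
Qed.

Lemma untranspose_scalable : scalable untranspose_fun.
Proof.
move=> a; apply: tensor_ext => [x y|x y|c q].
- by rewrite scalerBr untranspose_zmod.
- by rewrite untranspose_zmod scalerBr.
- by rewrite tensor_scaleE !untranspose_tens scalerA.
Qed.

Definition untranspose : ModHom (Ind_obj pi Omega) K :=
  HB.pack untranspose_fun
    (GRing.isZmodMorphism.Build _ _ _ untranspose_zmod)
    (GRing.isScalable.Build A _ _ *:%R _ untranspose_scalable).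

End Untranspose.

(** By [A]-linearity, [h (a \otimes \bar v) = a.h(1 \otimes \bar v)], so that
    [h] is recovered from its transpose. *)
Lemma transposeK : cancel transpose untranspose.
Proof.
move=> h; apply: Ind_ext => a v.
rewrite [LHS]untranspose_tens descend_bar.
rewrite -[LHS]/(a *: h (tens (incl pi) 1 (bar pi v))).
by rewrite -linearZ tensor_scaleE mulr1.
Qed.

Lemma untransposeK : cancel untranspose transpose.
Proof.
move=> g; apply: linear_ext => v.
by rewrite [LHS]untranspose_tens scale1r descend_bar.
Qed.

Hypothesis pi_lin : alg_linear pi.

(** The one place where the linearity of [pi] over the ground ring enters: the
    ground ring acts on [Res pi K] through [pi (c.1)] and on [K] through [c.1]. *)
Lemma kscale_Res c (x : K) : kscale c (x : Res_obj pi K) = kscale c x.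
Proof.
by rewrite -[LHS]/(pi (ascale c 1) *: x) pi_lin rmorph1.
Qed.

Lemma transpose_k_linear : linear transpose.
Proof.
move=> c f h; apply: linear_ext => v.
by congr (_ + _); exact: (esym (kscale_Res c _)).
Qed.

Definition transpose_lin :
    {linear ModHom (Ind pi Omega) K -> ModHom Omega (Res pi K)} :=
  HB.pack transpose (GRing.isLinear.Build k (ModHom (Ind_obj pi Omega) K)
    (ModHom Omega (Res_obj pi K)) *:%R _ transpose_k_linear).

End Transpose.

Section Adjunction.
Set Implicit Arguments.
Unset Strict Implicit.
Variables (k : pzRingType) (A B : algebra k) (pi : {rmorphism B -> A}).

Lemma transpose_natural (V V' : lmodType B) (K K' : lmodType A)
    (f : ModHom V' V) (g : ModHom K K') (h : ModHom (Ind_obj pi V) K) :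
  transpose (comp_Hom g (comp_Hom h (Ind_map pi f))) =
    comp_Hom (Res_map pi g) (comp_Hom (transpose h) f).
Proof.
apply: linear_ext => v.
rewrite -[LHS]/(g (h (Ind_map pi f (tens (incl pi) 1 (bar pi v))))).
by rewrite Ind_mapE.
Qed.

End Adjunction.

Theorem proposition2p6 (R : realType) (A B : algebra R[i])
    (pi : {rmorphism B -> A}) (pi_lin : alg_linear pi) :
  exists phi : forall (Omega : lmodType B) (K : lmodType A),
      {linear ModHom (Ind pi Omega) K -> ModHom Omega (Res pi K)},
    is_adjunction (F := Ind pi) (G := Res pi) phi.
Proof.
exists (fun Omega K => transpose_lin Omega K pi_lin); split=> [V K|].
  exact: (Bijective (@transposeK _ _ _ pi V K) (@untransposeK _ _ _ pi V K)).
by move=> V V' K K' f g h; exact: transpose_natural.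
Qed.
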